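(* Let $n>2$. The models $QI_n$ and $Mix_n$ have the same invariants; that is, the homogeneous ideals in $\mathbb{C}[P_{ijk}:1\le i,j,k\le n]$ of the projective varieties $V_{QI_n}$ and $V_{Mix_n}$ coincide.
   Context: We work over $\mathbb{C}$. The projective space $\mathbb{P}^{N}$, $N=n^3-1$, has homogeneous coordinates $P_{ijk}$, $1\le i,j,k\le n$, so its points are nonzero $n\times n\times n$ tensors up to scaling. The ''invariants'' of a model are the generators of the homogeneous ideal of the associated projective variety. $X_{n-1,n-1,n-1}$ is the Segre embedding of $\mathbb{P}^{n-1}\times\mathbb{P}^{n-1}\times\mathbb{P}^{n-1}$ in $\mathbb{P}^N$, i.e. the set of points with $P_{ijk}=a_ib_jc_k$. The variety of the quasi-independence model is $V_{QI_n}=X_{n-1,n-1,n-1}\star\mathcal{H}$, where $\mathcal{H}\subset\mathbb{P}^N$ is the linear variety of tensors all of whose non-diagonal entries ($P_{ijk}$ with $i,j,k$ not all equal) are equal to each other, the diagonal entries $P_{iii}$ being arbitrary. Here the Hadamard product $X\star Y$ of two projective varieties in the same projective space is the Zariski closure of the set of all coordinatewise products $p\star q$ with $p\in X$, $q\in Y$ that are not identically zero. (This corresponds to the parametrization $P_{iii}=\zeta\gamma_ia_ib_ic_i$ and $P_{ijk}=\zeta a_ib_jc_k$ for $i,j,k$ not all equal.) The variety of the mixture model is the join $V_{Mix_n}=J(X_{n-1,n-1,n-1},\mathcal{D})$, where $\mathcal{D}\subset\mathbb{P}^N$ is the linear variety of diagonal tensors ($P_{ijk}=0$ whenever $i,j,k$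 are not all equal), and $J(X,Y)$ is the Zariski closure of $\{\lambda Q+\mu R: Q\in X, R\in Y,\lambda,\mu\in\mathbb{C}^*\}$. (This corresponds to the parametrization $P_{iii}=\alpha a_ib_ic_i+(1-\alpha)d_i$ and $P_{ijk}=\alpha a_ib_jc_k$ for $i,j,k$ not all equal.) *)

(* Defs.v *)
From HB Require Import structures.
From mathcomp Require Import all_boot all_order all_algebra.
From mathcomp Require Import complex reals classical_sets.
From mathcomp Require Import mpoly.

Set Implicit Arguments.
Unset Strict Implicit.
Unset Printing Implicit Defensive.

Import GRing.Theory.
Local Open Scope ring_scope.
Local Open Scope classical_set_scope.

(* A subset of the projective space with homogeneous coordinates indexed by I
   is represented by the set of all its nonzero coordinate vectors: a set of
   nonzero vectors stable under multiplication by nonzero scalars. *)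
Section ProjectiveGeometry.
Variables (K : fieldType) (I : finType).

Local Notation coords := {ffun I -> K}.

(* The I-indexed variables are numbered through enum_val, since {mpoly K[m]}
   only has variables indexed by 'I_m. *)
Local Notation coord_ring := {mpoly K[#|I|]}.

Definition peval (f : coord_ring) (p : coords) : K :=
  f.@[fun v : 'I_#|I| => p (enum_val v)].

Definition homogeneous (f : coord_ring) : Prop :=
  exists d : nat, f \is d.-homog.

Definition zero_locus (F : set coord_ring) : set coords :=
  [set p : coords | p != 0 /\ forall f, F f -> peval f p = 0].

Definition zariski_closed (Z : set coords) : Prop :=
  exists2 F : set coord_ring, F `<=` homogeneous & Z = zero_locus F.

Definition zariski_closure (S : set coords) : set coords :=
  \bigcap_(Z in [set Z | zariski_closed Z /\ S `<=` Z]) Z.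

Definition generated_ideal (F : set coord_ring) : set coord_ring :=
  [set f | exists (m : nat) (h g : 'I_m -> coord_ring),
     (forall i, F (g i)) /\ f = \sum_(i < m) h i * g i].

Definition homogeneous_ideal (V : set coords) : set coord_ring :=
  generated_ideal
    [set f | homogeneous f /\ forall p, V p -> peval f p = 0].

Definition hadamard (p q : coords) : coords := [ffun i => p i * q i].

Definition hadamard_product (X Y : set coords) : set coords :=
  zariski_closure
    [set r : coords | r != 0 /\ exists p q, [/\ X p, Y q & r = hadamard p q]].

Definition join (X Y : set coords) : set coords :=
  zariski_closure
    [set r : coords | r != 0 /\ exists p q (lambda mu : K),
       [/\ X p, Y q, lambda != 0, mu != 0 &
           r = [ffun i => lambda * p i + mu * q i]]].

End ProjectiveGeometry.

Section Models.
Variables (K : fieldType) (n : nat).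

Definition index3 : finType := ('I_n * 'I_n * 'I_n)%type.

Local Notation tensor := {ffun index3 -> K}.

Definition diagonal (t : index3) : bool :=
  let: (i, j, k) := t in (i == j) && (j == k).

Definition segre : set tensor :=
  [set p : tensor | p != 0 /\ exists a b c : 'I_n -> K,
     forall i j k, p (i, j, k) = a i * b j * c k].

Definition equal_off_diagonal : set tensor :=
  [set p : tensor | p != 0 /\
     forall s t, ~~ diagonal s -> ~~ diagonal t -> p s = p t].

Definition diagonal_tensors : set tensor :=
  [set p : tensor | p != 0 /\ forall t, ~~ diagonal t -> p t = 0].

Definition V_QI : set tensor := hadamard_product segre equal_off_diagonal.

Definition V_Mix : set tensor := join segre diagonal_tensors.

End Models.

Arguments segre : clear implicits.
Arguments equal_off_diagonal : clear implicits.
Arguments diagonal_tensors : clear implicits.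
Arguments V_QI : clear implicits.
Arguments V_Mix : clear implicits.

(* Main.v *)
Require Import Defs.
From mathcomp Require Import all_boot all_order all_algebra.
From mathcomp Require Import complex reals classical_sets.
From mathcomp Require Import mpoly.

Set Implicit Arguments.
Unset Strict Implicit.
Unset Printing Implicit Defensive.

(** A homogeneous polynomial vanishes on a Zariski closure as soon as it vanishes
    on the original set, so it suffices to compare the two parametrized sets.
    Both lie in the set of tensors [a_i b_j c_k] with arbitrarily modified
    diagonal [d_i], and both contain every such tensor for which all the
    [a_i, b_i, c_i] are nonzero and [d_i <> a_i b_i c_i] for one [i]. Along the
    line [(a + s, b + s, c + s, d)] these genericity conditions fail for only
    finitely many [s], so a polynomial vanishing on either model vanishes on all
    these tensors. *)

Import GRing.Theory Num.Theory.
Local Open Scope ring_scope.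
Local Open Scope classical_set_scope.

(** The zero locus of a single homogeneous [f] is itself closed, so it contains the closure of [S]
    once it contains [S]. Since zero loci omit the origin, [S] must do so too. *)
Lemma homogeneous_ideal_closure (K : fieldType) (I : finType)
    (S : set {ffun I -> K}) :
  S `<=` [set p | p != 0] ->
  homogeneous_ideal (zariski_closure S) =
  generated_ideal [set f | homogeneous f /\ forall p, S p -> peval f p = 0].
Proof.
move=> S_neq0; congr generated_ideal; apply/seteqP; split=> f [fH f0].
  by split=> // p Sp; apply: f0 => Z [_]; apply.
split=> // p Sp.
have [_ ->//] : zero_locus [set f] p.
apply: Sp; split; first by exists [set f] => // _ ->.
by move=> q Sq; split=> [|_ ->]; [exact: S_neq0 | exact: f0].
Qed.

Lemma poly_eq0_horner (K : numDomainType) (p : {poly K}) :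
  (forall s, p.[s] = 0) -> p = 0.
Proof.
move=> p0; apply/eqP/negPn/negP => p_neq0.
(* Distinct naturals stay distinct in [K], which yields [size p] roots, one more than the degree
   allows. *)
pose rs : seq K := [seq i%:R | i <- iota 0 (size p)].
have rs_roots : all (root p) rs by apply/allP => x _; rewrite rootE p0.
have rs_uniq : uniq rs.
  rewrite map_inj_uniq ?iota_uniq // => i j /eqP.
  by rewrite eqr_nat => /eqP.
have := max_poly_roots p_neq0 rs_roots rs_uniq.
by rewrite size_map size_iota ltnn.
Qed.

Lemma horner_mmap (K : comNzRingType) (m : nat) (f : {mpoly K[m]})
    (u : 'I_m -> {poly K}) (s : K) :
  (mmap polyC u f).[s] = f.@[fun i => (u i).[s]].
Proof.
rewrite /meval !/mmap horner_sum; apply: eq_bigr => e _.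
rewrite hornerM hornerC; congr (_ * _).
by rewrite /mmap1 horner_prod; apply: eq_bigr => i _; rewrite horner_exp.
Qed.

(** Along the curve [u], [f] becomes a univariate polynomial [p]. The product [p * g] vanishes at
    every point, hence is zero, and [g] cancels in the domain [{poly K}]. *)
Lemma peval_line_eq0 (K : numFieldType) (I : finType) (f : {mpoly K[#|I|]})
    (u : I -> {poly K}) (g : {poly K}) :
  g != 0 ->
  (forall s, g.[s] != 0 -> peval f [ffun i => (u i).[s]] = 0) ->
  forall s, peval f [ffun i => (u i).[s]] = 0.
Proof.
move=> g_neq0 f0 s; pose p := mmap polyC (fun v => u (enum_val v)) f.
have pE x : peval f [ffun i => (u i).[x]] = p.[x].
  by rewrite horner_mmap; apply: meval_eq => v; rewrite ffunE.
suff p0 : p = 0 by rewrite pE p0 horner0.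
suff /eqP : p * g = 0 by rewrite mulf_eq0 (negPf g_neq0) orbF => /eqP.
apply: poly_eq0_horner => x; rewrite hornerM.
have [->|gx] := eqVneq g.[x] 0; first by rewrite mulr0.
by rewrite -pE f0 ?mul0r.
Qed.

Section DiagonalModification.
Variables (K : numFieldType) (n : nat).

Definition segre_tensor (a b c : 'I_n -> K) : {ffun index3 n -> K} :=
  [ffun t => a t.1.1 * b t.1.2 * c t.2].

Definition modified_segre_tensor (a b c d : 'I_n -> K) :
    {ffun index3 n -> K} :=
  [ffun t => if Defs.diagonal t then d t.1.1 else segre_tensor a b c t].

(** Fixing in advance the index [i0] at which [d] is generic makes genericity the non-vanishing of a
    single polynomial along the line. *)
Lemma homogeneous_ideal_modified_segre (S : set {ffun index3 n -> K})
    (i0 : 'I_n) :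
  S `<=` [set r | r != 0] ->
  (forall r, S r -> exists a b c d, r = modified_segre_tensor a b c d) ->
  (forall a b c d, (forall i, [/\ a i != 0, b i != 0 & c i != 0]) ->
     d i0 != a i0 * b i0 * c i0 -> S (modified_segre_tensor a b c d)) ->
  homogeneous_ideal (zariski_closure S) =
  generated_ideal [set f | homogeneous f /\
    forall a b c d, peval f (modified_segre_tensor a b c d) = 0].
Proof.
move=> S_neq0 Sparam Sgen; rewrite homogeneous_ideal_closure //.
congr generated_ideal; apply/seteqP; split=> f [fH f0]; split=> //; last first.
  by move=> r /Sparam[a [b [c [d ->]]]].
move=> a b c d.
pose h (v : 'I_n -> K) i : {poly K} := 'X + (v i)%:P.
pose u (t : index3 n) : {poly K} :=
  if Defs.diagonal t then (d t.1.1)%:P else h a t.1.1 * h b t.1.2 * h c t.2.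
pose q := (d i0)%:P - h a i0 * h b i0 * h c i0.
(* The roots of [g] are exactly the parameters [s] at which genericity fails. *)
pose g := (\prod_i (h a i * h b i * h c i)) * q.
have h_neq0 v i : h v i != 0 by rewrite -size_poly_eq0 size_XaddC.
have g_neq0 : g != 0.
  rewrite mulf_neq0 //; first by apply/prodf_neq0 => i _; rewrite !mulf_neq0.
  (* A product of three linear polynomials has size 4, a constant at most 1. *)
  rewrite subr_eq0; apply/eqP => /(congr1 (size : {poly K} -> nat)).
  rewrite !size_mul ?mulf_neq0 // !size_XaddC => E.
  by have := size_polyC_leq1 (d i0); rewrite E.
have uE s : [ffun t => (u t).[s]] = modified_segre_tensor
    (fun i => s + a i) (fun i => s + b i) (fun i => s + c i) d.
  apply/ffunP => t; rewrite !ffunE /u; case: ifP => _; first by rewrite hornerC.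
  by rewrite !hornerM !hornerD !hornerX !hornerC.
have -> : modified_segre_tensor a b c d = [ffun t => (u t).[0]].
  by rewrite uE; apply/ffunP => t; rewrite !ffunE !add0r.
apply: (peval_line_eq0 g_neq0) => s; rewrite uE hornerM mulf_eq0 negb_or.
rewrite horner_prod => /andP[/prodf_neq0 abc_neq0 q_neq0].
apply: f0; apply: Sgen => [i|].
  have := abc_neq0 i isT.
  by rewrite !hornerM !hornerD !hornerX !hornerC !mulf_eq0 !negb_or
    => /andP[/andP[]].
move: q_neq0; rewrite hornerD hornerN !hornerM !hornerD !hornerX !hornerC.
by rewrite subr_eq0.
Qed.

Lemma segre_tensor_in_segre (a b c : 'I_n -> K) (i0 : 'I_n) :
  (forall i, [/\ a i != 0, b i != 0 & c i != 0]) ->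
  segre K n (segre_tensor a b c).
Proof.
move=> abc; split; last by exists a, b, c => i j k; rewrite ffunE.
apply/eqP => /ffunP/(_ (i0, i0, i0)); rewrite !ffunE /=; apply/eqP.
by have [? ? ?] := abc i0; rewrite !mulf_neq0.
Qed.

Lemma modified_segre_tensor_neq0 (a b c d : 'I_n -> K) (i0 i1 : 'I_n) :
  i0 != i1 ->
  (forall i, [/\ a i != 0, b i != 0 & c i != 0]) ->
  modified_segre_tensor a b c d != 0.
Proof.
move=> i01 abc; apply/eqP => /ffunP/(_ (i0, i1, i1)).
rewrite !ffunE /= (negPf i01) /=; apply/eqP.
by have [[? _ _] [_ ? ?]] := (abc i0, abc i1); rewrite !mulf_neq0.
Qed.

Lemma V_QI_ideal (i0 i1 : 'I_n) : i0 != i1 ->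
  homogeneous_ideal (V_QI K n) = generated_ideal [set f | homogeneous f /\
    forall a b c d, peval f (modified_segre_tensor a b c d) = 0].
Proof.
move=> i01.
apply: (@homogeneous_ideal_modified_segre _ i0); first by move=> r [].
  move=> r [_ [p [q [[_ [a [b [c pE]]]] [_ qE] ->]]]].
  (* The common off-diagonal value of [q], read at [(i0, i1, i1)], is absorbed into [a]. *)
  exists (fun i => q (i0, i1, i1) * a i), b, c,
    (fun i => a i * b i * c i * q (i, i, i)).
  apply/ffunP => -[[i j] k]; rewrite !ffunE pE /=.
  case: ifPn => [/andP[/eqP <- /eqP <-] // | ndiag].
  by rewrite (qE _ (i0, i1, i1)) /= ?(negPf i01) // [LHS]mulrC !mulrA.
move=> a b c d abc _; split; first exact: (modified_segre_tensor_neq0 _ i01).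
exists (segre_tensor a b c).
(* The diagonal factor is the quotient that turns [a i * b i * c i] into [d i]. *)
exists [ffun t => if Defs.diagonal t then
  d t.1.1 / (a t.1.1 * b t.1.1 * c t.1.1) else 1]; split.
- exact: (segre_tensor_in_segre i0).
- split=> [|s t ns nt]; last by rewrite !ffunE (negPf ns) (negPf nt).
  apply/eqP => /ffunP/(_ (i0, i1, i1)).
  by rewrite !ffunE /= (negPf i01) /=; apply/eqP; rewrite oner_eq0.
apply/ffunP => -[[i j] k]; rewrite !ffunE /=.
case: ifPn => [/andP[/eqP <- /eqP <-]|_]; last by rewrite mulr1.
by have [? ? ?] := abc i; rewrite mulrC divfK // !mulf_neq0.
Qed.

Lemma V_Mix_ideal (i0 i1 : 'I_n) : i0 != i1 ->
  homogeneous_ideal (V_Mix K n) = generated_ideal [set f | homogeneous f /\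
    forall a b c d, peval f (modified_segre_tensor a b c d) = 0].
Proof.
move=> i01.
apply: (@homogeneous_ideal_modified_segre _ i0); first by move=> r [].
  move=> r [_ [p [q [l [m [[_ [a [b [c pE]]]] [_ qE] _ _ ->]]]]]].
  exists (fun i => l * a i), b, c,
    (fun i => l * (a i * b i * c i) + m * q (i, i, i)).
  apply/ffunP => -[[i j] k]; rewrite !ffunE pE /=.
  case: ifPn => [/andP[/eqP <- /eqP <-] // | ndiag].
  by rewrite qE // mulr0 addr0 !mulrA.
move=> a b c d abc d_gen; split; first exact: (modified_segre_tensor_neq0 _ i01).
exists (segre_tensor a b c).
(* The difference is supported on the diagonal; by [d_gen] its entry at [i0] is nonzero, so it is a
   genuine projective point. *)
exists [ffun t => modified_segre_tensor a b c d t - segre_tensor a b c t], 1, 1.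
split; rewrite ?oner_eq0 //.
- exact: (segre_tensor_in_segre i0).
- split=> [|t nt]; last by rewrite !ffunE (negPf nt) subrr.
  apply/eqP => /ffunP/(_ (i0, i0, i0)).
  by rewrite !ffunE /= !eqxx /=; apply/eqP; rewrite subr_eq0.
by apply/ffunP => t; rewrite !ffunE !mul1r addrC subrK.
Qed.

End DiagonalModification.

Theorem proposition5p1 (R : realType) (n : nat) (hn : (2 < n)%N) :
  homogeneous_ideal (V_QI R[i] n) = homogeneous_ideal (V_Mix R[i] n).
Proof.
pose i0 := Ordinal (ltnW (ltnW hn)); pose i1 := Ordinal (ltnW hn).
have i01 : i0 != i1 by [].
by rewrite (V_QI_ideal _ i01) (V_Mix_ideal _ i01).
Qed.
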